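(* Every outer $k$-planar graph $G$ on $n$ vertices has at most $\sqrt{\frac{87723}{16000}k}\;n \approx 2.34\sqrt{k}\,n$ edges.
   Context: Here $k\ge 0$ is an integer. A convex geometric graph is a drawing of a finite simple graph in the plane whose vertex set is a set of points in convex position (no three collinear) and whose edges are drawn as straight-line segments between their endpoints. Two edges cross if they share a point in their relative interiors. The drawing is $k$-plane if each edge crosses at most $k$ other edges. A graph is outer $k$-planar if it admits a convex geometric $k$-plane drawing.
   Formalization: The theorem is proved for k ≥ 2 only; the stated bound is false for k = 0 (a single edge on two vertices) and for k = 1 (K4's glued along outer edges give 61 edges on n = 26 vertices, above 60.88). *)

(* Defs.v *)
From mathcomp Require Import all_boot all_order all_algebra.
From mathcomp Require Import boolp classical_sets reals convex.

Set Implicit Arguments.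
Unset Strict Implicit.
Unset Printing Implicit Defensive.

Import Order.TTheory GRing.Theory Num.Theory.

Local Open Scope classical_set_scope.
Local Open Scope ring_scope.

(* A finite simple graph is a symmetric irreflexive relation [e] on a finite
   type; its edges are the unordered pairs of adjacent vertices. *)
Definition edges (V : finType) (e : rel V) : {set {set V}} :=
  [set [set xy.1; xy.2]%SET | xy : V * V & e xy.1 xy.2]%SET.

(* No point lies in the convex hull of the others. In particular the points are
   pairwise distinct and no three of them are collinear. *)
Definition convex_position (R : realType) (V : finType) (p : V -> 'rV[R]_2) :=
  forall v : V, ~ smallest (@convex_set R 'rV[R]_2) (p @` [set~ v]) (p v).

(* The relative interior of the segment that draws the edge [E]. *)
Definition edge_interior (R : realType) (V : finType) (p : V -> 'rV[R]_2)
    (E : {set V}) : set 'rV[R]_2 :=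
  [set x | exists (a b : V) (t : R),
    [/\ E = [set a; b]%SET, 0 < t < 1 & x = (1 - t) *: p a + t *: p b]].

Definition crosses (R : realType) (V : finType) (p : V -> 'rV[R]_2)
    (E F : {set V}) : Prop :=
  edge_interior p E `&` edge_interior p F !=set0.

Definition kplane (R : realType) (k : nat) (V : finType) (e : rel V)
    (p : V -> 'rV[R]_2) : Prop :=
  forall E : {set V}, E \in edges e ->
    (#|[set F in edges e | (F != E) && `[< crosses p E F >]]%SET| <= k)%N.

Definition outer_kplanar (R : realType) (k : nat) (V : finType) (e : rel V) :
    Prop :=
  exists p : V -> 'rV[R]_2, convex_position p /\ kplane k e p.

(* Main.v *)
Require Import Defs.
From mathcomp Require Import all_boot all_order all_algebra.
From mathcomp Require Import boolp classical_sets reals convex.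
From mathcomp Require Import interval_inference zify ring lra.
From mathcomp.boot Require Import fintype finset.
Import Order.TTheory GRing.Theory Num.Theory.

Set Implicit Arguments.
Unset Strict Implicit.
Unset Printing Implicit Defensive.

(** Points in convex position have a cyclic order, and two edges whose endpoints
    alternate in that order cross.  So the drawing is a set of chords on [n]
    linearly ordered vertices, in which each chord alternates with at most [k]
    others, and the geometry is used for nothing else.

    The density comes from deleting arcs.  Fix [L].  If there are more edges than
    pairs of vertices with fewer than [L] vertices between them, some edge skips
    [L] or more vertices; let [f] be one skipping the least number [i] of
    vertices.  Delete the [i] vertices under [f].  A lost edge either crosses [f],
    which at most [k] edges do, or joins two vertices of the closed arc of [f],
    and then it skips fewer than [L] vertices by minimality of [f].  The arc has
    [i + 2] vertices, so the number of lost edges is at most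
    [k + L (i + 2) - L (L + 1) / 2].  As [i >= L], this is at most
    [k / L + (L + 3) / 2] edges per deleted vertex, and by induction the graph
    has at most [(k / L + (L + 3) / 2) n] edges ([chord_density]).  For [L] near
    [sqrt (2 k)] the factor is about [sqrt (2 k) + 3 / 2], which is below
    [sqrt (27 k / 5)] when [k >= 3] ([exists_arc_length]); and [27 / 5] is
    less than [87723 / 16000].

    For [k = 2] every [L] gives too much, and the same deletion is sharpened to
    the bound [3 n - 5] ([chord_density2]).  With [L = 2] the induction only fails
    if [i = 2], the four vertices of the closed arc of [f] are pairwise adjacent,
    and two edges leave the arc across [f].  Such a leaving edge [g] crosses [f]
    and an edge inside the arc, so no further edge crosses [g]: after the
    deletion, [f] aside, the graph falls into the two sides of [g], which share
    one vertex, and the induction hypothesis for both sides suffices.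

    For the cyclic order, take any vertex [o] and sort the others by the
    orientation of the triangles at [o].  That this is a linear order, and that
    all triangles [x < y < z] are then positively oriented, holds because
    otherwise some point would be in the convex hull of three others. *)

(** * Sets of chords on linearly ordered vertices *)

Section ChordDiagrams.
Local Open Scope nat_scope.
Context (V : finType) (r : V -> nat) (r_inj : injective r).
Implicit Types (A B : {set V}) (E : {set V * V}) (f g : V * V).

Definition oriented E := forall f, f \in E -> r f.1 < r f.2.

(** Deletion of vertices is a change of [A] with [E] fixed, so bounds on the
    number of crossings in [E] are inherited by every induced subgraph. *)
Definition induced E A := [set f in E | (f.1 \in A) && (f.2 \in A)].

Definition open_arc A f := [set z in A | r f.1 < r z < r f.2].

Definition cross f g :=
  (r f.1 < r g.1 < r f.2) && (r f.2 < r g.2) ||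
  (r g.1 < r f.1 < r g.2) && (r g.2 < r f.2).

Lemma crossC f g : cross f g = cross g f.
Proof. exact: orbC. Qed.

Definition crossers E f := [set g in E | cross f g].

(** The number of pairs in a linear order of [n] elements that have fewer than
    [L] elements between them: the element of rank [j] is the upper end of
    [minn L j] of these pairs. *)
Definition short_bound L n := \sum_(j < n) minn L j.

Lemma short_boundS L n : short_bound L n.+1 = short_bound L n + minn L n.
Proof. by rewrite /short_bound big_ord_recr. Qed.

Lemma short_bound_le L n : short_bound L n <= L * n.
Proof.
elim: n => [|n IH]; first by rewrite /short_bound big_ord0.
by rewrite short_boundS; lia.
Qed.

Lemma short_boundE L n : L <= n -> 2 * short_bound L n + L * L.+1 = 2 * L * n.
Proof.
elim: n L => [|n IH] L; first by case: L => // _; rewrite /short_bound big_ord0.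
rewrite leq_eqVlt ltnS short_boundS => /orP[/eqP-> | Ln]; last first.
  by have := IH L Ln; lia.
have -> : short_bound n.+1 n = short_bound n n.
  by apply: eq_bigr => j _; have := ltn_ord j; lia.
by have := IH n (leqnn n); nia.
Qed.

Lemma rank_neq x y : x != y -> r x != r y.
Proof. by apply: contraNneq => /r_inj->. Qed.

(** By removing the last vertex [y]: the set [X] of lower ends of short chords to
    [y] has at most [L] elements, as the first of them has the others between it
    and [y]. *)
Lemma card_short_chords E A L : oriented E ->
  #|[set f in induced E A | #|open_arc A f| < L]| <= short_bound L #|A|.
Proof.
move=> orE; move: {2}#|A| (erefl #|A|) => n; elim: n A => [|n IH] A cardA.
  have /eqP A0 : A == set0 by rewrite -cards_eq0 cardA.
  rewrite (leq_trans _ (leq0n _)) // leqn0 cards_eq0; apply/eqP/setP=> f.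
  by rewrite A0 !inE /= !andbF.
have /card_gt0P[x0 Ax0] : 0 < #|A| by rewrite cardA.
have [y Ay ymax] : exists2 y, y \in A & forall z, z \in A -> r z <= r y.
  by have [y ? ?] := arg_maxnP (fun z => r z) Ax0; exists y.
have cardAy : #|A :\ y| = n by rewrite (cardsD1 y) Ay in cardA; case: cardA.
pose X := [set x in A :\ y | #|open_arc A (x, y)| < L].
have ltXy x : x \in A :\ y -> r x < r y.
  rewrite 2!inE => /andP[/rank_neq neq_xy /ymax].
  by rewrite leq_eqVlt (negPf neq_xy).
have leXn : #|X| <= n.
  rewrite -cardAy subset_leq_card //.
  by apply/subsetP=> x; rewrite inE => /andP[].
have leXL : #|X| <= L.
  have [->|/set0Pn[x1 Xx1]] := eqVneq X set0; first by rewrite cards0.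
  have [x Xx xmin] : exists2 x, x \in X & forall z, z \in X -> r x <= r z.
    by have [x ? ?] := arg_minnP (fun z => r z) Xx1; exists x.
  have [Ax ltL] : x \in A :\ y /\ #|open_arc A (x, y)| < L.
    by move: Xx; rewrite inE => /andP.
  rewrite (cardsD1 x) Xx (leq_trans _ ltL) // ltnS subset_leq_card //.
  apply/subsetP=> z; rewrite 2!inE => /andP[/rank_neq neq_zx Xz].
  have Az : z \in A :\ y by move: Xz; rewrite inE => /andP[].
  rewrite inE (subsetP (subsetDl A [set y]) _ Az) ltXy // andbT ltn_neqAle eq_sym neq_zx.
  exact: xmin.
rewrite cardA short_boundS -[in short_bound _ _]cardAy.
have sub : [set f in induced E A | #|open_arc A f| < L] \subset
   [set f in induced E (A :\ y) | #|open_arc (A :\ y) f| < L] :|: [set (x, y) | x in X].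
  apply/subsetP=> -[x z]; rewrite !inE /= -!andbA => /and4P[Exz Ax Az ltL].
  have /= ltxz := orE _ Exz.
  have neq_xy : x != y by apply: contraTneq ltxz => ->; rewrite -leqNgt ymax.
  have [eq_zy|neq_zy] := eqVneq z y.
    apply/orP; right; rewrite -eq_zy; apply/imsetP; exists x => //.
    by rewrite !inE Ax -eq_zy ltL andbT eq_zy neq_xy.
  apply/orP; left; rewrite Exz neq_xy Ax Az /= (leq_ltn_trans _ ltL) //.
  by rewrite subset_leq_card //; apply/subsetP=> u; rewrite !inE => /andP[/andP[_ ->]].
apply: leq_trans (subset_leq_card sub) (leq_trans (leq_card_setU _ _) _).
rewrite leq_add //; first exact: IH.
by rewrite (leq_trans (leq_imset_card _ _)) // leq_min leXL leXn.
Qed.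

Definition closed_arc A f := [set z in A | r f.1 <= r z <= r f.2].

Lemma card_closed_arc A f : f.1 \in A -> f.2 \in A -> r f.1 < r f.2 ->
  #|closed_arc A f| = #|open_arc A f|.+2.
Proof.
case: f => a b /= Aa Ab ltab.
have -> : closed_arc A (a, b) = a |: (b |: open_arc A (a, b)).
  apply/setP=> z; rewrite !inE /=.
  have [->|/rank_neq nza] := eqVneq z a; first by rewrite Aa; lia.
  have [->|/rank_neq nzb] := eqVneq z b; first by rewrite Ab; lia.
  by case: (z \in A) => //; lia.
have neq_ab : a != b by apply: contraTneq ltab => ->; rewrite ltnn.
by rewrite !cardsU1 !inE /= (negPf neq_ab) Aa Ab !ltnn ltab.
Qed.

Lemma card_del_open_arc A f : #|A| = #|A :\: open_arc A f| + #|open_arc A f|.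
Proof.
rewrite -[LHS](cardsID (open_arc A f)) addnC (setIidPr _) //.
by apply/subsetP=> z; rewrite inE => /andP[].
Qed.

(** Among the chords skipping at least [L] vertices, [f] skips the fewest.  Every
    other chord inside its closed arc skips strictly fewer vertices, so it is
    short; this bounds the chords in the closed arc.  A chord that meets the open
    arc and leaves the closed one crosses [f].  The strict inequality accounts
    for [f], which lies in two of the three sets on the right. *)
Lemma exists_tight_chord E A L : oriented E -> short_bound L #|A| < #|induced E A| ->
  exists f, [/\ f \in induced E A, L <= #|open_arc A f|,
    #|induced E A| < #|induced E (A :\: open_arc A f)| + #|induced E (closed_arc A f)|
                     + #|crossers (induced E A) f|
  & #|induced E (closed_arc A f)| <= (short_bound L #|open_arc A f|.+2).+1].
Proof.
move=> orE ltSE.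
have [f0 /andP[Ef0 longf0]] : exists f, (f \in induced E A) && (L <= #|open_arc A f|).
  apply/existsP; apply: contraTT ltSE; rewrite negb_exists -leqNgt => /forallP short.
  apply: leq_trans (card_short_chords A L orE); apply/subset_leq_card/subsetP=> f Ef.
  by have := short f; rewrite inE Ef -ltnNge.
have [f [Ef longf minf]] : exists f, [/\ f \in induced E A, L <= #|open_arc A f|
    & forall g, g \in induced E A -> L <= #|open_arc A g| ->
        #|open_arc A f| <= #|open_arc A g|].
  have := @arg_minnP _ f0 (fun f => (f \in induced E A) && (L <= #|open_arc A f|))
    (fun f => #|open_arc A f|).
  case=> [|f /andP[? ?] minf]; first by rewrite Ef0.
  by exists f; split=> // g Eg longg; apply: minf; rewrite Eg.
move: (Ef); rewrite inE => /andP[Ef' /andP[Af1 Af2]].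
have ltf := orE _ Ef'.
have Ef_arc : f \in induced E (closed_arc A f) by rewrite !inE Ef' Af1 Af2 !leqnn ltnW.
exists f; split=> //.
- set I := open_arc A f; set B := closed_arc A f.
  have sub : induced E A \subset
      induced E (A :\: I) :|: (induced E B :\ f) :|: crossers (induced E A) f.
    apply/subsetP=> g Eg; rewrite !in_setU in_setD1.
    have [->|_] := eqVneq g f; first by rewrite !inE Ef' Af1 Af2 !ltnn andbF.
    move: Eg; rewrite !inE => /and3P[Eg -> ->]; rewrite Eg /cross.
    by have := orE _ Eg; clear -ltf; lia.
  rewrite (cardsD1 f (induced E B)) Ef_arc add1n addnS addSn ltnS.
  apply: leq_trans (subset_leq_card sub) (leq_trans (leq_card_setU _ _) _).
  by rewrite leq_add2r leq_card_setU.
- rewrite (cardsD1 f) Ef_arc ltnS -(card_closed_arc Af1 Af2 ltf).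
  apply: leq_trans (card_short_chords _ L orE); apply/subset_leq_card/subsetP=> g.
  rewrite 2!inE => /andP[neq_gf Eg]; rewrite inE Eg /=.
  move: Eg; rewrite !inE => /and3P[Eg /and3P[Ag1 le_fg1 _] /and3P[Ag2 _ le_g2f]].
  have ltg := orE _ Eg.
  have lt_arc : #|open_arc A g| < #|open_arc A f|.
    apply: proper_card; apply/properP; split.
      apply/subsetP=> z; rewrite !inE => /andP[->].
      by clear -le_fg1 le_g2f; lia.
    have [eq1|/rank_neq neq1] := eqVneq g.1 f.1.
      have /rank_neq neq2 : g.2 != f.2.
        by apply: contraNneq neq_gf => eq2;
          rewrite [g]surjective_pairing eq1 eq2 -surjective_pairing.
      exists g.2; rewrite inE Ag2 /= -?eq1; last by rewrite ltnn andbF.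
      by clear -ltg le_g2f neq2; lia.
    exists g.1; rewrite inE Ag1 /=; last by rewrite ltnn.
    by clear -ltg le_fg1 le_g2f neq1; lia.
  have : ~~ (L <= #|open_arc A g|).
    apply: contraTN lt_arc => longg; rewrite -leqNgt minf //.
    by rewrite inE Eg Ag1 Ag2.
  rewrite -ltnNge; apply: leq_ltn_trans; apply/subset_leq_card/subsetP=> z.
  by rewrite !inE => /andP[/andP[-> _]].
Qed.

(** The density [k / L + (L + 3) / 2], with denominators cleared.  The condition
    on [L] says that this density is at least [L]; so a graph too sparse to have
    a chord skipping [L] vertices satisfies the bound, and deleting more than [L]
    vertices at once does no harm. *)
Lemma chord_density E L k A : oriented E ->
    (forall f, f \in E -> #|crossers E f| <= k) ->
    0 < L -> L * L <= 2 * k + 3 * L ->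
  2 * L * #|induced E A| <= (2 * k + L * (L + 3)) * #|A|.
Proof.
move=> orE crE L0 leLk; move: {2}#|A|.+1 (ltnSn #|A|) => n.
elim: n A => // n IH A ltAn.
(* Either all chords may be short, or a tight chord exists. *)
have [/leq_trans short|] := leqP #|induced E A| (short_bound L #|A|).
  by have := short _ (short_bound_le L #|A|); nia.
case/(exists_tight_chord orE)=> f [Ef longf le_delete le_arc].
have cardA := card_del_open_arc A f.
have /IH le_del : #|A :\: open_arc A f| < n by lia.
have le_cr : #|crossers (induced E A) f| <= k.
  apply: leq_trans (crE f _); last by move: Ef; rewrite inE => /andP[].
  by apply/subset_leq_card/subsetP=> g; rewrite !inE => /andP[/andP[->]].
have /short_boundE short : L <= #|open_arc A f|.+2 by lia.
rewrite cardA; nia.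
Qed.

(** [short_bound n n] is the number of all pairs of [n] vertices; with one more
    chord the induced graph would exceed it. *)
Lemma mem_of_complete E A x y : oriented E ->
    short_bound #|A| #|A| <= #|induced E A| ->
  x \in A -> y \in A -> r x < r y -> (x, y) \in E.
Proof.
move=> orE full Ax Ay ltxy; apply: contraLR full => nExy; rewrite -ltnNge.
pose E' := (x, y) |: E.
have orE' : oriented E' by move=> f /setU1P[->|/orE].
apply: leq_trans (card_short_chords A #|A| orE').
have <- : #|(x, y) |: induced E A| = #|induced E A|.+1.
  by rewrite cardsU1 inE (negPf nExy).
apply/subset_leq_card/subsetP=> f Ef.
have : f \in induced E' A.
  by move: Ef; rewrite !inE => /predU1P[->|/and3P[-> -> ->]]; rewrite ?eqxx ?Ax ?Ay ?orbT.
move=> E'f; rewrite inE E'f /=; apply/proper_card/properP.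
split; first by apply/subsetP=> z; rewrite inE => /andP[].
move: E'f; rewrite inE => /and3P[_ Af _].
by exists f.1; rewrite // inE ltnn andbF.
Qed.

(** Let [g] leave from [u] under [f], and let [s] be the other vertex under [f].
    The chord [h] joins [s] to the end of [f] that lies beyond [u] as seen from
    [s], so [h] jumps over [u] inside the arc and [g] crosses it. *)
Lemma outgoing_chord_crosses_arc E A f g : oriented E ->
    #|open_arc A f| = 2 -> f \in induced E A -> g \in induced E A ->
    cross f g -> (forall x y, x \in closed_arc A f -> y \in closed_arc A f ->
      r x < r y -> (x, y) \in E) ->
  exists h, [/\ h \in crossers E g, h != f & h \notin induced E (A :\: open_arc A f)].
Proof.
move=> orE card2; rewrite !inE => /and3P[Ef Af1 Af2] /and3P[Eg Ag1 Ag2] crfg full.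
have ltf := orE _ Ef; have ltg := orE _ Eg.
have Bf1 : f.1 \in closed_arc A f by rewrite inE Af1 leqnn ltnW.
have Bf2 : f.2 \in closed_arc A f by rewrite inE Af2 leqnn ltnW.
have [u [Iu ug]] : exists u, u \in open_arc A f /\ ((u = g.1) \/ (u = g.2)).
  have [lt1|le1] := boolP (r f.1 < r g.1 < r f.2).
    by exists g.1; rewrite inE Ag1; split=> //; left.
  exists g.2; rewrite inE Ag2; split; last by right.
  by move: crfg le1; rewrite /cross; clear; lia.
have /card_gt0P[s] : 0 < #|open_arc A f :\ u|.
  by move: card2; rewrite (cardsD1 u) Iu; case: #|_|.
rewrite in_setD1 => /andP[/rank_neq neq_su Is].
have := Is; rewrite inE => /andP[As lts].
have Bs : s \in closed_arc A f by rewrite inE As; clear -lts; lia.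
have := Iu; rewrite inE => /andP[Au ltu].
have [lt_us|lt_su|] := ltngtP (r u) (r s); last by move=> e; rewrite e eqxx in neq_su.
- exists (f.1, s); rewrite !inE /= lts As !andbF; split=> //.
    rewrite full //=; last by case/andP: lts.
    by case: ug => ug; subst u; move: crfg; rewrite /cross /=;
      clear -lts ltu lt_us ltg; lia.
  by apply: contraTneq lts => <- /=; rewrite ltnn andbF.
- exists (s, f.2); rewrite !inE /= lts As /= ?andbF; split=> //.
    rewrite full //=; last by case/andP: lts.
    by case: ug => ug; subst u; move: crfg; rewrite /cross /=;
      clear -lts ltu lt_su ltg; lia.
  by apply: contraTneq lts => <- /=; rewrite ltnn.
Qed.

(** The bound [3 n - 5] leaves room for splitting.  In the critical case 5 edges
    of the complete graph on the closed arc, [f] itself and the two edges crossing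
    [f] are removed, 8 in all, and the two sides of [g] have [n - 1] vertices in
    total: [8 + (3 a - 5) + (3 b - 5)] with [a + b = n - 1] is [3 n - 5]. *)
Lemma chord_density2 E A : oriented E ->
    (forall f, f \in E -> #|crossers E f| <= 2) -> 1 < #|A| ->
  #|induced E A| + 5 <= 3 * #|A|.
Proof.
move=> orE crE; move: {2}#|A|.+1 (ltnSn #|A|) => n.
elim: n A => // n IH A ltAn leA2; rewrite leqNgt; apply/negP=> dense.
have short2 := short_boundE leA2.
have /(exists_tight_chord orE)[f [Ef longf le_delete le_arc]] :
  short_bound 2 #|A| < #|induced E A| by lia.
have cardA := card_del_open_arc A f.
have [Ef' Af1 Af2] : [/\ f \in E, f.1 \in A & f.2 \in A].
  by move: Ef; rewrite inE => /and3P[].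
have ltf := orE _ Ef'.
have crossers_sub g : crossers (induced E A) g \subset crossers E g.
  by apply/subsetP=> h; rewrite !inE => /andP[/andP[->]].
have le_cr : #|crossers (induced E A) f| <= 2.
  exact: leq_trans (subset_leq_card (crossers_sub f)) (crE f Ef').
have neq_f : f.1 != f.2 by apply: contraTneq ltf => ->; rewrite ltnn.
have le_del : #|induced E (A :\: open_arc A f)| + 5 <= 3 * #|A :\: open_arc A f|.
  apply: IH; first by lia.
  have /subset_leq_card : [set f.1; f.2] \subset A :\: open_arc A f.
    by apply/subsetP=> z /set2P[]->; rewrite !inE ?Af1 ?Af2 ltnn ?andbF.
  by rewrite cards2 neq_f.
(* With [i] vertices under [f], the counts force [i <= #crossings <= 2 <= i]. *)
have short_arc : 2 <= #|open_arc A f|.+2 by lia.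
move/short_boundE: short_arc => short_arc.
have card2 : #|open_arc A f| = 2 by lia.
have card_B : #|closed_arc A f| = 4 by rewrite card_closed_arc // card2.
have full : 6 <= #|induced E (closed_arc A f)| by lia.
have /card_gt0P[g] : 0 < #|crossers (induced E A) f| by lia.
rewrite inE => /andP[Eg crfg].
have [h [hg neq_hf nIh]] : exists h,
    [/\ h \in crossers E g, h != f & h \notin induced E (A :\: open_arc A f)].
  apply: outgoing_chord_crosses_arc card2 Ef Eg crfg _ => // x y.
  apply: mem_of_complete => //.
  by rewrite card_B; have := short_boundE (leqnn 4); lia.
have [Eg' Ag1 Ag2] : [/\ g \in E, g.1 \in A & g.2 \in A].
  by move: Eg; rewrite inE => /and3P[].
have ltg := orE _ Eg'.
have only_fh x : x \in crossers E g -> (x == h) || (x == f).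
  have sub_fh : [set h; f] \subset crossers E g.
    by apply/subsetP=> z /set2P[]-> //; rewrite inE Ef' crossC.
  have /eqP <- : [set h; f] == crossers E g.
    by rewrite eqEcard sub_fh cards2 neq_hf crE.
  by rewrite !inE.
(* The two sides of [g]; they share only the end of [g] outside the arc. *)
pose A1 := [set z in A :\: open_arc A f | r g.1 <= r z <= r g.2].
pose A2 := [set z in A :\: open_arc A f | (r z <= r g.1) || (r g.2 <= r z)].
have sub : induced E (A :\: open_arc A f) \subset f |: (induced E A1 :|: induced E A2).
  apply/subsetP=> x xI; rewrite in_setU1; have [//|neq_xf /=] := eqVneq x f.
  have ncr : ~~ cross g x.
    have : x \notin crossers E g.
      apply/negP=> /only_fh; rewrite (negPf neq_xf) orbF => /eqP eq_xh.
      by rewrite -eq_xh xI in nIh.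
    by move: xI; rewrite !inE => /andP[->].
  move: xI; rewrite !inE => /and3P[Ex -> ->]; rewrite Ex /=.
  by have := orE _ Ex; move: ncr; rewrite /cross; clear -ltg; lia.
(* [v] is the end of [g] outside the arc; [w1] and [w2] are the ends of [f],
   separated by [g], so each side keeps two vertices for the induction. *)
have [v [w1 [w2 [A1w A2w sub_v]]]] : exists v w1 w2,
    [/\ [set v; w1] \subset A1 /\ v != w1, [set v; w2] \subset A2 /\ v != w2
      & A1 :&: A2 \subset [set v]].
  have pair (B : {set V}) x y : x \in B -> y \in B -> r x != r y ->
      [set x; y] \subset B /\ x != y.
    move=> Bx By neq_xy; split; first by apply/subsetP=> z /set2P[]->.
    by apply: contraNneq neq_xy => ->.
  have [/andP[lt1 lt2]|/andP[lt1 lt2]] := orP crfg.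
  - exists g.2, f.2, f.1; split; try apply: pair; rewrite ?inE ?Af1 ?Af2 ?Ag2 /=;
      try by clear -lt1 lt2 ltf ltg; lia.
    by apply/subsetP=> z; rewrite !inE => zA12; apply/eqP/r_inj;
      clear -lt1 lt2 ltf ltg zA12; lia.
  - exists g.1, f.1, f.2; split; try apply: pair; rewrite ?inE ?Af1 ?Af2 ?Ag1 /=;
      try by clear -lt1 lt2 ltf ltg; lia.
    by apply/subsetP=> z; rewrite !inE => zA12; apply/eqP/r_inj;
      clear -lt1 lt2 ltf ltg zA12; lia.
have card1 : 1 < #|A1|.
  by case: A1w => /subset_leq_card + neq_vw; rewrite cards2 neq_vw.
have card2' : 1 < #|A2|.
  by case: A2w => /subset_leq_card + neq_vw; rewrite cards2 neq_vw.
have card12 : #|A1| + #|A2| <= (#|A :\: open_arc A f|).+1.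
  rewrite -cardsUI -addn1 leq_add //; last by rewrite -(cards1 v) subset_leq_card.
  by apply/subset_leq_card/subsetP=> z; rewrite !inE; clear; lia.
have lt1 : #|A1| < n by clear -card12 card2' cardA card2 ltAn; lia.
have lt2 : #|A2| < n by clear -card12 card1 cardA card2 ltAn; lia.
have le_split : #|induced E (A :\: open_arc A f)| <= 1 + (#|induced E A1| + #|induced E A2|).
  apply: leq_trans (subset_leq_card sub) (leq_trans (leq_card_setU _ _) _).
  by rewrite cards1 leq_add2l leq_card_setU.
have le1 := IH _ lt1 card1; have le2 := IH _ lt2 card2'.
clear -dense le_delete le_arc le_cr short_arc card2 cardA card12 le_split le1 le2; lia.
Qed.

End ChordDiagrams.

Local Open Scope ring_scope.

(** * The cyclic order of points in convex position *)

Ltac weights_lra :=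
  match goal with
  | |- is_true (_ <= _) => lra
  | |- is_true (_ < _) => lra
  | |- _ => idtac
  end.

Lemma ranking (V : finType) (lt : rel V) : irreflexive lt -> transitive lt ->
    (forall x y, x != y -> lt x y || lt y x) ->
  exists2 r : V -> nat, injective r & forall x y, (r x < r y)%N -> lt x y.
Proof.
move=> irr trans total; pose r x := #|[set z | lt z x]%SET|.
have r_mono x y : lt x y -> (r x < r y)%N.
  move=> lt_xy; apply/proper_card/properP; split.
    by apply/subsetP=> z; rewrite !inE => /trans; apply.
  by exists x; rewrite inE ?irr.
exists r => [x y eq_r|x y ltr].
  by apply/eqP; apply: contraT => /total/orP[] /r_mono; rewrite eq_r ltnn.
have [eq_xy|/total/orP[//|/r_mono]] := eqVneq x y; first by rewrite eq_xy ltnn in ltr.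
by rewrite ltnNge ltnW.
Qed.

Section Geometry.
Context (R : realType).
Implicit Types x y z : 'rV[R]_2.

Lemma convex_mem2 (M : set 'rV[R]_2) x y z (a b : R) :
    @convex_set R 'rV[R]_2 M -> M x -> M y -> 0 <= a -> 0 <= b -> 0 < a + b ->
  (a + b) *: z = a *: x + b *: y -> M z.
Proof.
move=> cM Mx My a0 b0 ab0 zE.
have t0 : 0 <= a / (a + b) by rewrite divr_ge0 // ltW.
have t1 : a / (a + b) <= 1 by rewrite ler_pdivrMr // mul1r; lra.
have := set_mem (cM x y (Itv01 t0 t1) (mem_set Mx) (mem_set My)).
congr M; rewrite /conv /= /unstable.onem.
have ab_neq0 : a + b != 0 by rewrite gt_eqF.
apply: (scalerI ab_neq0); rewrite zE scalerDr !scalerA mulrC divfK //; congr (_ + _ *: _).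
by rewrite mulrBr mulr1 mulrC divfK // addrC addKr.
Qed.

Lemma row2_eq x y : x 0 0 = y 0 0 -> x 0 1 = y 0 1 -> x = y.
Proof.
move=> eq0 eq1; apply/rowP=> i.
by have [->|->] : i = 0 \/ i = 1 by case: i => [[|[]]] // ?; [left|right]; apply: val_inj.
Qed.

(** Twice the signed area of the triangle, positive when it is traversed
    counterclockwise. *)
Definition orient x y z : R :=
  (y 0 0 - x 0 0) * (z 0 1 - x 0 1) - (y 0 1 - x 0 1) * (z 0 0 - x 0 0).

(** The affine dependence of four points in the plane: read as an equality of two
    combinations with positive weights, it is the crossing point of the diagonals
    of a convex quadrilateral; with other signs, it puts one of the points in the
    triangle of the others. *)
Lemma orient_affine x y z w :
  orient y z w *: x + orient x y w *: z = orient x z w *: y + orient x y z *: w.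
Proof. by apply: row2_eq; rewrite !mxE /orient; ring. Qed.

Lemma orient_sum x y z w :
  orient y z w + orient x y w = orient x z w + orient x y z.
Proof. by rewrite /orient; ring. Qed.

Lemma orientyy x y : orient x y y = 0.
Proof. by rewrite /orient; ring. Qed.

Lemma orientC x y z : orient x z y = - orient x y z.
Proof. by rewrite /orient; ring. Qed.

Context (V : finType) (p : V -> 'rV[R]_2) (p_cvx : convex_position p).
Implicit Types a b c d o u v w : V.

(** The weights need not sum to 1, so that orientations can serve as weights; the
    points may coincide, which covers hulls of one or two points. *)
Lemma no_hull3 v a b c (ka kb kc : R) : v != a -> v != b -> v != c ->
    0 <= ka -> 0 <= kb -> 0 <= kc -> 0 < ka + kb + kc ->
  (ka + kb + kc) *: p v = ka *: p a + kb *: p b + kc *: p c -> False.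
Proof.
move=> neq_a neq_b neq_c ka0 kb0 kc0 k0 eq_v.
apply: (p_cvx (v := v)) => M [cM sub].
have inM u : v != u -> M (p u).
  by move=> neq_u; apply: sub; exists u => //= eq_u; rewrite eq_u eqxx in neq_u.
have [k_eq0|k_neq0] := eqVneq (ka + kb) 0.
  have [ka_eq0 kb_eq0] : ka = 0 /\ kb = 0 by lra.
  apply: (convex_mem2 (a := kc) (b := 0) cM (inM c neq_c) (inM c neq_c)) => //; first lra.
  by move: eq_v; rewrite ka_eq0 kb_eq0 !scale0r !add0r !addr0.
have k1 : 0 < ka + kb by rewrite lt_neqAle eq_sym k_neq0 addr_ge0.
pose y := (ka + kb)^-1 *: (ka *: p a + kb *: p b).
have My : M y.
  apply: (convex_mem2 cM (inM a neq_a) (inM b neq_b) ka0 kb0 k1).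
  by rewrite /y scalerA divff // scale1r.
apply: (convex_mem2 cM My (inM c neq_c) (ltW k1) kc0 k0).
by rewrite eq_v /y scalerA divff // scale1r.
Qed.

Lemma convex_position_inj : injective p.
Proof.
move=> a b eq_ab; apply/eqP; apply: contraT => neq_ab; exfalso.
apply: (@no_hull3 a b b b 1 0 0) => //; weights_lra.
by rewrite !addr0 !scale0r !addr0 eq_ab.
Qed.

(** The weights of a dependence of three points sum to 0, so one of them has a sign
    opposite to the other two, and its point lies between these. *)
Lemma no_affine_dependence a b c (ka kb kc : R) :
    a != b -> a != c -> b != c -> ka + kb + kc = 0 -> ka != 0 ->
  ka *: p a + kb *: p b + kc *: p c = 0 -> False.
Proof.
move=> neq_ab neq_ac neq_bc.
wlog ka0 : ka kb kc / 0 < ka => [wl|] sum0 ka_neq0 dep.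
  have [ka_lt0|ka_gt0|] := ltgtP ka 0; last by move/eqP: ka_neq0.
    apply: (wl (- ka) (- kb) (- kc)); rewrite ?oppr_gt0 ?oppr_eq0 //; first lra.
    by rewrite !scaleNr -!opprD dep oppr0.
  exact: (wl ka kb kc).
have [neq_ba neq_ca neq_cb] : [/\ b != a, c != a & c != b] by rewrite !(eq_sym _ a) (eq_sym c).
have [kb_le0|kb_gt0] := leP kb 0; have [kc_le0|kc_gt0] := leP kc 0.
- apply: (@no_hull3 a b c c (- kb) (- kc) 0) => //; weights_lra.
  rewrite scale0r addr0 !addr0 !scaleNr (_ : - kb - kc = ka); last by lra.
  by apply/eqP; rewrite -subr_eq0 opprD !opprK addrA dep.
- apply: (@no_hull3 b a c c ka kc 0) => //; weights_lra.
  rewrite scale0r addr0 !addr0 (_ : ka + kc = - kb); last by lra.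
  by apply/eqP; rewrite eq_sym -subr_eq0 scaleNr opprK addrAC dep.
- apply: (@no_hull3 c a b b ka kb 0) => //; weights_lra.
  rewrite scale0r addr0 !addr0 (_ : ka + kb = - kc); last by lra.
  by apply/eqP; rewrite eq_sym -subr_eq0 scaleNr opprK dep.
- by exfalso; lra.
Qed.

(** If the area vanishes, then for either coordinate the differences of that
    coordinate are the weights of an affine dependence; so they vanish, and the
    points coincide. *)
Lemma orient_neq0 a b c : a != b -> a != c -> b != c -> orient (p a) (p b) (p c) != 0.
Proof.
move=> neq_ab neq_ac neq_bc; apply/eqP=> orient0.
have dep (i : 'I_2) : p a 0 i = p b 0 i.
  apply/eqP; apply: contraT => neq_i; exfalso.
  apply: (@no_affine_dependence c a b (p b 0 i - p a 0 i) (p c 0 i - p b 0 i)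
           (p a 0 i - p c 0 i)) => //; try by rewrite eq_sym.
    by ring.
    by rewrite subr_eq0 eq_sym.
  have [->|->] : i = 0 \/ i = 1 by case: i {neq_i} => [[|[]]] // ?; [left|right]; apply: val_inj.
  - apply: row2_eq; rewrite !mxE; first by ring.
    by rewrite -orient0 /orient; ring.
  - apply: row2_eq; rewrite !mxE; last by ring.
    by rewrite -[RHS]oppr0 -orient0 /orient; ring.
by have /convex_position_inj/eqP := row2_eq (dep 0) (dep 1); apply/negP.
Qed.

(** Otherwise the three triangles at [o] wind around [o], which is then in the
    triangle [a b c]. *)
Lemma orient_trans o a b c : o != a -> o != b -> o != c ->
    0 < orient (p o) (p a) (p b) -> 0 < orient (p o) (p b) (p c) ->
  0 < orient (p o) (p a) (p c).
Proof.
move=> oa ob oc oab obc.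
have neq_ac : a != c.
  by apply: contraTneq oab => ->; rewrite orientC; lra.
have := orient_neq0 oa oc neq_ac; rewrite neq_lt => /orP[oac|//]; exfalso.
apply: (@no_hull3 o a b c (orient (p o) (p b) (p c)) (- orient (p o) (p a) (p c))
  (orient (p o) (p a) (p b))) => //; weights_lra.
rewrite (_ : _ + _ = orient (p a) (p b) (p c)).
  apply/eqP; rewrite -(inj_eq (addIr (orient (p o) (p a) (p c) *: p b))).
  by rewrite orient_affine scaleNr addrAC subrK.
by have := orient_sum (p o) (p a) (p b) (p c); lra.
Qed.

(** Otherwise [b], which is seen from [o] between [a] and [c], is in the triangle
    [o a c]. *)
Lemma orient_gt0 o a b c : o != a -> o != b -> o != c ->
    0 < orient (p o) (p a) (p b) -> 0 < orient (p o) (p b) (p c) ->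
  0 < orient (p a) (p b) (p c).
Proof.
move=> oa ob oc oab obc; have oac := orient_trans oa ob oc oab obc.
have neq_ba : b != a by apply: contraTneq oab => ->; rewrite orientyy ltxx.
have neq_bc : b != c by apply: contraTneq obc => ->; rewrite orientyy ltxx.
rewrite ltNge; apply/negP=> abc.
apply: (@no_hull3 b o a c (- orient (p a) (p b) (p c)) (orient (p o) (p b) (p c))
  (orient (p o) (p a) (p b))); rewrite 1?(eq_sym b o) //; weights_lra.
rewrite (_ : _ + _ = orient (p o) (p a) (p c)); last first.
  by have := orient_sum (p o) (p a) (p b) (p c); lra.
by rewrite -addrA -orient_affine scaleNr addKr.
Qed.

(** The affine dependence of [a], [b], [c], [d] has positive weights on [a] and [c]
    on one side and on [b] and [d] on the other; after division by their common
    sum both sides are the crossing point. *)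
Lemma crosses_of_orient_gt0 a b c d :
    0 < orient (p a) (p b) (p c) -> 0 < orient (p a) (p b) (p d) ->
    0 < orient (p a) (p c) (p d) -> 0 < orient (p b) (p c) (p d) ->
  crosses p [set a; c] [set b; d].
Proof.
move=> abc abd acd bcd.
have interior u v (s t : R) : 0 < s -> 0 < t ->
    edge_interior p [set u; v] ((s + t)^-1 *: (s *: p u + t *: p v)).
  move=> s0 t0; have st_neq0 : s + t != 0 by rewrite gt_eqF // addr_gt0.
  exists u, v, (t / (s + t)); split=> //.
    by rewrite divr_gt0 ?addr_gt0 //= ltr_pdivrMr ?addr_gt0 // mul1r ltrDr.
  rewrite scalerDr !scalerA [(s + t)^-1 * t]mulrC; congr (_ *: _ + _).
  by rewrite -[1](divff st_neq0) -mulrBl addrK mulrC.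
have ac := interior a c _ _ bcd abd; have bd := interior b d _ _ acd abc.
rewrite orient_affine orient_sum in ac.
by exists ((orient (p a) (p c) (p d) + orient (p a) (p b) (p c))^-1 *:
  (orient (p a) (p c) (p d) *: p b + orient (p a) (p b) (p c) *: p d)).
Qed.

Lemma convex_cyclic_order : exists2 r : V -> nat, injective r &
  forall a b c d, (r a < r b)%N -> (r b < r c)%N -> (r c < r d)%N ->
    crosses p [set a; c] [set b; d].
Proof.
(* [o] comes first, and the others follow counterclockwise around it. *)
have [o _|V0] := pickP V; last by exists (fun=> 0%N) => a; have := V0 a.
pose before u v := (v != o) && ((u == o) || (0 < orient (p o) (p u) (p v))).
have irr : irreflexive before.
  by move=> u; rewrite /before andb_orr andNb orientyy ltxx andbF.
have trans : transitive before.
  move=> v u w /andP[neq_vo uv] /andP[neq_wo vw]; rewrite /before neq_wo /=.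
  move: uv vw; rewrite (negPf neq_vo) /=; have [//|neq_uo /=] := eqVneq u o.
  by apply: orient_trans; rewrite eq_sym.
have total u v : u != v -> before u v || before v u.
  move=> neq_uv; rewrite /before.
  have [eq_uo|neq_uo /=] := eqVneq u o; first by rewrite -eq_uo eq_sym neq_uv.
  have [//|neq_vo /=] := eqVneq v o.
  rewrite [orient _ (p v) _]orientC oppr_gt0 orbC -neq_lt.
  by apply: orient_neq0 => //; rewrite eq_sym.
have [r r_inj r_before] := ranking irr trans total; exists r => // a b c d ab bc cd.
have pos u v w : (r u < r v)%N -> (r v < r w)%N -> 0 < orient (p u) (p v) (p w).
  move=> /r_before/andP[neq_vo uv] /r_before/andP[neq_wo vw].
  move: uv vw; rewrite (negPf neq_vo) /=; have [->//|neq_uo /=] := eqVneq u o.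
  by apply: orient_gt0; rewrite eq_sym.
have ac := ltn_trans ab bc; have bd := ltn_trans bc cd.
by apply: crosses_of_orient_gt0; apply: pos.
Qed.

End Geometry.

(** * The choice of the arc length *)

Section Lengths.
Local Open Scope nat_scope.

Lemma sqrt_between (K : nat) : exists L, L * L <= K < L.+1 * L.+1.
Proof.
elim: K => [|K [L /andP[le_LK lt_KL]]]; first by exists 0.
have [lt_K|] := boolP (K.+1 < L.+1 * L.+1); first by exists L; lia.
by rewrite -leqNgt => le_K; exists L.+1; lia.
Qed.

(** [L] is the integer part of [sqrt (2 k)].  With [2 k = L ^ 2 + t], the claim is a
    quadratic inequality in [t], whose square term is absorbed by [t <= 2 L]; the
    rest holds for all [t] once it does at [t = 0], that is for [L >= 3].  For
    [L = 2] only [k = 3] and [k = 4] occur. *)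
Lemma exists_arc_length (k : nat) : 2 < k -> exists L,
  [/\ 0 < L, L * L <= 2 * k + 3 * L &
      5 * (2 * k + L * (L + 3)) ^ 2 <= 27 * k * (2 * L) ^ 2].
Proof.
move=> k3; have [L /andP[le_L lt_L]] := sqrt_between (2 * k).
have L2 : 1 < L by nia.
exists L; split; [lia|lia|rewrite !expnS !expn0 !muln1].
have [L_eq|L3] : L = 2 \/ 2 < L by lia.
  by subst L; have [->|->] : k = 3 \/ k = 4 by lia.
have [t kE] : exists t, 2 * k = L * L + t by exists (2 * k - L * L); lia.
have tt : t * t <= 2 * L * t by nia.
have tL : 40 * (L * t) <= 34 * (L * L * t) by nia.
have LL : 5 * ((2 * L + 3) * (2 * L + 3)) <= 54 * (L * L) by nia.
have := leq_mul LL (leqnn (L * L)) => LLLL.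
have kL : 27 * k * (2 * L * (2 * L)) = 54 * ((L * L + t) * (L * L)) by nia.
rewrite kL kE; lia.
Qed.

End Lengths.

(** The density [a / b] is compared with the square root through its square, where
    [27 / 5 < 87723 / 16000] is all that is needed. *)
Lemma le_sqrt_density (R : realType) (m n k a b : nat) :
    (0 < b)%N -> (b * m <= a * n)%N -> (5 * a ^ 2 <= 27 * k * b ^ 2)%N ->
  m%:R <= Num.sqrt (87723%:R / 16000%:R * k%:R) * n%:R :> R.
Proof.
move=> b0 le_mn le_ab; have b0R : (0 : R) < b%:R by rewrite ltr0n.
have le_abR : 5 * a%:R ^+ 2 <= 27 * k%:R * b%:R ^+ 2 :> R.
  by rewrite -!natrX -!natrM ler_nat.
apply: (@le_trans _ _ (a%:R / b%:R * n%:R)).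
  by rewrite mulrAC ler_pdivlMr // mulrC -!natrM ler_nat.
apply: ler_wpM2r; first exact: ler0n.
rewrite -[leLHS]ger0_norm ?divr_ge0 ?ler0n // -sqrtr_sqr ler_wsqrtr //.
rewrite expr_div_n ler_pdivrMr ?exprn_gt0 //.
have kb0 : 0 <= k%:R * b%:R ^+ 2 :> R by rewrite mulr_ge0 ?exprn_ge0 ?ler0n.
by move: le_abR kb0; rewrite -!mulrA; set kb := _ * b%:R ^+ 2; lra.
Qed.

(** * From drawings to chords *)

Section Transfer.
Context (R : realType) (V : finType) (e : rel V) (p : V -> 'rV[R]_2).
Context (r : V -> nat) (r_inj : injective r).
Implicit Types (f g : V * V).

Definition oriented_edges := [set f : V * V | e f.1 f.2 && (r f.1 < r f.2)%N]%SET.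

Definition ends f : {set V} := [set f.1; f.2]%SET.

Lemma ends_inj : {in oriented_edges &, injective ends}.
Proof.
move=> [a b] [c d]; rewrite !inE /ends /= => /andP[_ ab] /andP[_ cd] /setP eq_ends.
have := eq_ends d; have := eq_ends c; rewrite !inE !eqxx ?orbT.
move=> /orP[]/eqP cE /orP[]/eqP dE; subst => //; first by rewrite ltnn in cd.
  by rewrite ltnNge ltnW in cd.
by rewrite ltnn in cd.
Qed.

Lemma card_edges : symmetric e -> irreflexive e -> (#|edges e| <= #|oriented_edges|)%N.
Proof.
move=> e_sym e_irr; apply: leq_trans (leq_imset_card ends _).
apply/subset_leq_card/subsetP=> E /imsetP[[a b]]; rewrite inE /= => eab ->.
have : r a != r b by apply: contraTneq eab => /r_inj->; rewrite e_irr.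
rewrite neq_ltn => /orP[ab|ba].
  by apply/imsetP; exists (a, b); rewrite // inE eab.
apply/imsetP; exists (b, a); first by rewrite inE /= e_sym eab.
by rewrite /ends setUC.
Qed.

Context (r_crosses : forall a b c d, (r a < r b)%N -> (r b < r c)%N -> (r c < r d)%N ->
  crosses p [set a; c] [set b; d]).

Lemma cross_crosses f g : cross r f g -> crosses p (ends f) (ends g).
Proof.
case/orP=> /andP[/andP[lt1 lt2] lt3]; first exact: r_crosses.
by rewrite /crosses classical_sets.setIC; exact: r_crosses.
Qed.

Lemma card_crossers k : kplane k e p ->
  forall f, f \in oriented_edges -> (#|crossers r oriented_edges f| <= k)%N.
Proof.
move=> kpl f Ef; have in_edges g : g \in oriented_edges -> ends g \in edges e.
  by rewrite inE => /andP[eg _]; apply/imsetP; exists g; rewrite // inE.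
apply: leq_trans (kpl _ (in_edges f Ef)).
rewrite -(card_in_imset (f := ends)); last first.
  by move=> g h; rewrite !inE => /andP[Eg _] /andP[Eh _]; apply: ends_inj; rewrite inE.
apply/subset_leq_card/subsetP=> F /imsetP[g]; rewrite inE => /andP[Eg crfg] ->.
rewrite inE in_edges //=; apply/andP; split; last exact/asboolP/cross_crosses.
apply: contraTneq crfg => /ends_inj -> //.
by rewrite /cross !ltnn.
Qed.

End Transfer.

Theorem theorem6 (R : realType) (k : nat) (hk : (2 <= k)%N)
    (V : finType) (e : rel V) (e_sym : symmetric e) (e_irr : irreflexive e)
    (hG : outer_kplanar R k e) :
  #|edges e|%:R <= Num.sqrt (87723%:R / 16000%:R * k%:R) * #|V|%:R :> R.
Proof.
have [p [p_cvx p_kpl]] := hG.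
have [r r_inj r_crosses] := convex_cyclic_order p_cvx.
pose E := oriented_edges e r.
have orE : oriented r E by move=> f; rewrite inE => /andP[].
have crE := card_crossers r_crosses p_kpl.
have inducedT : induced E [set: V]%SET = E by apply/setP=> f; rewrite [LHS]inE !in_setT !andbT.
have le_edges : (#|edges e| <= #|E|)%N := card_edges r_inj e_sym e_irr.
rewrite -cardsT; move: hk; rewrite leq_eqVlt => /orP[/eqP k2|].
  subst k; apply: (@le_sqrt_density _ _ _ _ 3 1) => //; rewrite mul1n.
  apply: leq_trans le_edges _; have [V2|V1] := ltnP 1 #|[set: V]%SET|.
    have := chord_density2 r_inj orE crE V2; rewrite inducedT.
    by apply: leq_trans; rewrite leq_addr.
  rewrite (_ : #|E| = 0%N) //; apply/eqP; rewrite cards_eq0; apply/eqP/setP=> -[a b].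
  rewrite !inE /=; apply/negP=> /andP[eab _].
  have /card_le1P := V1; move/(_ a (in_setT _) b); rewrite in_setT => /esym/eqP ba.
  by rewrite ba e_irr in eab.
case/exists_arc_length=> L [L0 le_L le_ab].
apply: (le_sqrt_density _ (a := 2 * k + L * (L + 3)) (b := 2 * L)) => //.
  by rewrite muln_gt0.
apply: leq_trans (chord_density r_inj setT orE crE L0 le_L).
by rewrite inducedT leq_mul2l le_edges orbT.
Qed.
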